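(* If $w$ is a unitary in $\mathcal{Q}_2^{\mathbb{T}}$ such that $w\mathcal{O}_2w^*\subset\mathcal{O}_2$, then $w\in\mathcal{F}_2$ and the inclusion is actually an equality, i.e. $w\mathcal{O}_2w^*=\mathcal{O}_2$.
   Context: The $2$-adic ring $C^*$-algebra $\mathcal{Q}_2$ is the universal $C^*$-algebra generated by a unitary $U$ and an isometry $S_2$ such that $S_2U=U^2S_2$ and $S_2S_2^*+US_2S_2^*U^*=1$. Put $S_1:=US_2$. The Cuntz algebra $\mathcal{O}_2$ is identified with the $C^*$-subalgebra $C^*(S_1,S_2)\subset\mathcal{Q}_2$. The gauge automorphisms $\widetilde{\alpha}_\theta$ ($\theta\in\mathbb{R}$) of $\mathcal{Q}_2$ are determined by $\widetilde{\alpha}_\theta(S_2)=e^{i\theta}S_2$, $\widetilde{\alpha}_\theta(U)=U$; $\mathcal{Q}_2^{\mathbb{T}}$ denotes the fixed-point subalgebra of $\mathcal{Q}_2$ under all $\widetilde{\alpha}_\theta$, and $\mathcal{F}_2:=\mathcal{O}_2\cap\mathcal{Q}_2^{\mathbb{T}}$ is the gauge-invariant subalgebra of $\mathcal{O}_2$ (the UHF algebra of type $2^\infty$). *)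

(* Defs.v *)
From HB Require Import structures.
From mathcomp Require Import all_boot all_order all_algebra.
From mathcomp Require Import all_classical all_reals all_analysis.
From mathcomp Require Import complex.

Set Implicit Arguments.
Unset Strict Implicit.
Unset Printing Implicit Defensive.

Import Order.TTheory GRing.Theory Num.Theory.
Import numFieldNormedType.Exports.

Local Open Scope classical_set_scope.
Local Open Scope ring_scope.

(* Unital complex C*-algebras.  The norm of a normed module over [R[i]] takes
   its values in [R[i]], in the nonnegative reals.  The library's algebras
   satisfy [1 != 0], so that the zero algebra is left out.  This is a record
   over a Banach space and not an [HB.structure], because Hierarchy-Builder
   refuses a join of normed modules and rings which is not a [numDomainType];
   both structures are put on the carrier right below. *)
Record cstarAlgType (R : realType) := CstarAlg {
  cstar_base : completeNormedModType R[i];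
  cstar_one : cstar_base;
  cstar_mul : cstar_base -> cstar_base -> cstar_base;
  cstar_star : cstar_base -> cstar_base;
  cstar_mulA : associative cstar_mul;
  cstar_mul1l : left_id cstar_one cstar_mul;
  cstar_mul1r : right_id cstar_one cstar_mul;
  cstar_mulDl : left_distributive cstar_mul +%R;
  cstar_mulDr : right_distributive cstar_mul +%R;
  cstar_one_neq0 : cstar_one != 0;
  cstar_scaleAl : forall (a : R[i]) x y,
    a *: cstar_mul x y = cstar_mul (a *: x) y;
  cstar_scaleAr : forall (a : R[i]) x y,
    a *: cstar_mul x y = cstar_mul x (a *: y);
  cstar_starK : involutive cstar_star;
  cstar_starD : {morph cstar_star : x y / x + y};
  cstar_starZ : forall (a : R[i]) x,
    cstar_star (a *: x) = a^* *: cstar_star x;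
  cstar_starM : forall x y,
    cstar_star (cstar_mul x y) = cstar_mul (cstar_star y) (cstar_star x);
  cstar_normM_le : forall x y, `|cstar_mul x y| <= `|x| * `|y|;
  cstar_normE : forall x, `|cstar_mul (cstar_star x) x| = `|x| ^+ 2
}.

Definition cstar_sort (R : realType) (A : cstarAlgType R) : Type :=
  cstar_base A.
Coercion cstar_sort : cstarAlgType >-> Sortclass.

HB.instance Definition _ (R : realType) (A : cstarAlgType R) :=
  CompleteNormedModule.copy (cstar_sort A) (cstar_base A).
HB.instance Definition _ (R : realType) (A : cstarAlgType R) :=
  GRing.Zmodule_isNzRing.Build (cstar_sort A) (@cstar_mulA R A)
    (@cstar_mul1l R A) (@cstar_mul1r R A) (@cstar_mulDl R A) (@cstar_mulDr R A)
    (@cstar_one_neq0 R A).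
HB.instance Definition _ (R : realType) (A : cstarAlgType R) :=
  GRing.Lmodule_isLalgebra.Build R[i] (cstar_sort A) (@cstar_scaleAl R A).
HB.instance Definition _ (R : realType) (A : cstarAlgType R) :=
  GRing.Lalgebra_isAlgebra.Build R[i] (cstar_sort A) (@cstar_scaleAr R A).

Definition star (R : realType) (A : cstarAlgType R) : A -> A :=
  @cstar_star R A.

Section CstarAlgebraTheory.
Variable R : realType.
Implicit Types A B : cstarAlgType R.

Definition isometry_element A (s : A) : Prop := star s * s = 1.

Definition unitary_element A (u : A) : Prop := star u * u = 1 /\ u * star u = 1.

(* Elements of [{lrmorphism A -> B}] are unital. *)
Definition star_preserving A B (f : {lrmorphism A -> B}) : Prop :=
  {morph f : x / star x}.

Definition star_automorphism A (f : {lrmorphism A -> A}) : Prop :=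
  star_preserving f /\ bijective f.

(* Subalgebras need not contain [1]. *)
Definition cstar_subalgebra A (D : set A) : Prop :=
  [/\ closed D,
      D 0 /\ forall (a : R[i]) x y, D x -> D y -> D (a *: x + y),
      forall x y, D x -> D y -> D (x * y)
    & forall x, D x -> D (star x)].

Definition cstar_generated A (E : set A) : set A :=
  smallest (@cstar_subalgebra A) E.

End CstarAlgebraTheory.

Section TwoAdicRingAlgebra.
Variable R : realType.
Implicit Types A B : cstarAlgType R.

Definition Q2_relations A (U S2 : A) : Prop :=
  [/\ unitary_element U, isometry_element S2, S2 * U = U ^+ 2 * S2
    & S2 * star S2 + U * S2 * star S2 * star U = 1].

(* [A] is the universal C*-algebra of the relations, with generators [U] and
   [S2].  Two *-homomorphisms which agree on generators are equal, so that the
   homomorphism below is unique. *)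
Definition is_Q2 A (U S2 : A) : Prop :=
  [/\ Q2_relations U S2,
      cstar_generated [set U; S2] = setT
    & forall B (u s : B), Q2_relations u s ->
        exists f : {lrmorphism A -> B},
          [/\ star_preserving f, f U = u & f S2 = s]].

Definition O2 A (U S2 : A) : set A := cstar_generated [set U * S2; S2].

Definition expi (theta : R) : R[i] := (cos theta +i* sin theta)%C.

Definition gauge_automorphisms A (U S2 : A)
    (alpha : R -> {lrmorphism A -> A}) : Prop :=
  forall theta, [/\ star_automorphism (alpha theta),
    alpha theta S2 = expi theta *: S2 & alpha theta U = U].

Definition fixed_points A (alpha : R -> {lrmorphism A -> A}) : set A :=
  [set x | forall theta, alpha theta x = x].

Definition F2 A (U S2 : A) (alpha : R -> {lrmorphism A -> A}) : set A :=
  O2 U S2 `&` fixed_points alpha.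

End TwoAdicRingAlgebra.

(* Main.v *)
Require Import Defs.
From HB Require Import structures.
From mathcomp Require Import all_boot all_order all_algebra.
From mathcomp Require Import all_classical all_reals all_analysis.
From mathcomp Require Import complex lra zify.

Import Order.TTheory GRing.Theory Num.Theory.
Import numFieldNormedType.Exports.

Local Open Scope classical_set_scope.
Local Open Scope ring_scope.

Set Implicit Arguments.
Unset Strict Implicit.
Unset Printing Implicit Defensive.

(** Write [s = S2], [t = U * S2] and [phi z = s z star s + t z star t], the
canonical shift.  Picture the algebra on l2(Z), with [s e_k = e_(2k)] and
[U e_k = e_(k+1)], so that [s] and [t] append a binary digit 0 or 1.  Both
generators [s], [t] of the Cuntz algebra then preserve the span of the [e_k]
with [k >= 0] and the span of those with [k < 0], whereas [U] sends [e_(-1)] to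
[e_0].  A gauge-invariant element is close to some
[c0 + c1 phi^n(U) + c2 phi^n(star U)] where the [c_i] are gauge-invariant
elements of the Cuntz algebra that commute with the range of [phi^n]
([laurent_approx]); the last two terms are the ones that connect the two
halves.  It thus suffices that [w] does not connect them.

Let [P] be the projection onto the half [k >= 0].  The hypothesis puts
[x_n = w phi^n(star w)] in the gauge-invariant core ([shift_cocycle_core]), so
[x_n] is a unitary commuting with [P], and [w = x_n phi^n(w)].  Since [phi^n(w)]
acts on the leading digits only, [P w e_k] has the same norm as [P w e_(-1)]
for every [k < 0].  But [w] is close to an operator that moves indices by a
bounded amount, so these norms tend to 0 as [k] tends to minus infinity; hence
they vanish.

The proof replaces this picture by elements of the algebra.  The projections
[p_l = phi^l(s star s)], which test one digit, stand for [P]: they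
asymptotically commute with every gauge-invariant element of the Cuntz algebra,
because such an element is a limit of elements commuting with the range of some
[phi^m] ([core_asymptotically_central]).  The isometries [t^l], words of ones,
stand for [e_(-1)].  The vanishing becomes [p_l w t^(l+1) --> 0]
([off_diagonal_vanish]), and implies that [c1] is as small as the approximation
error ([laurent_coefficient_le]).  Exchanging [(U, s, t)] for [(star U, t, s)]
gives the same for [c2].  So [w] is a limit of the [c0], which lie in the Cuntz
algebra.

The approximation lemmas average over gauge automorphisms
([graded_fixed_closure]), which requires that unital star-homomorphisms are
contractive ([unital_star_hom_contractive]). *)

(** * Norm and involution *)

Section Norm.
Variables (R : realType) (A : cstarAlgType R).
Implicit Types x y z : A.

(** The norm of the algebra takes its values in [R[i]]; its real part makes the
order arguments ones about [R]. *)
Definition nrm x : R := complex.Re `|x|.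

Lemma nrmE x : `|x| = (nrm x)%:C%C.
Proof. by rewrite /nrm RRe_real// ger0_real. Qed.

Lemma nrm_ge0 x : 0 <= nrm x.
Proof. by rewrite -lecR -nrmE normr_ge0. Qed.

Lemma nrm0_eq0 x : nrm x = 0 -> x = 0.
Proof. by move=> h; apply/eqP; rewrite -normr_eq0 nrmE h. Qed.

Lemma nrm0 : nrm 0 = 0.
Proof. by rewrite /nrm normr0. Qed.

Lemma nrmD x y : nrm (x + y) <= nrm x + nrm y.
Proof. by rewrite -lecR rmorphD /= -!nrmE ler_normD. Qed.

Lemma nrmN x : nrm (- x) = nrm x.
Proof. by rewrite /nrm normrN. Qed.

Lemma nrmB x y : nrm (x - y) = nrm (y - x).
Proof. by rewrite /nrm distrC. Qed.

Lemma nrmZ (a : R[i]) (r : R) x : `|a| = r%:C%C -> nrm (a *: x) = r * nrm x.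
Proof.
by move=> ar; apply: (@complexI R); rewrite rmorphM /= -!nrmE normrZ ar.
Qed.

Lemma nrm_half x : nrm (2^-1 *: x) = 2^-1 * nrm x.
Proof.
by apply: nrmZ; rewrite gtr0_norm ?invr_gt0// fmorphV rmorph_nat.
Qed.

Lemma nrmM x y : nrm (x * y) <= nrm x * nrm y.
Proof. by rewrite -lecR rmorphM /= -!nrmE cstar_normM_le. Qed.

Lemma nrmM_le1r y z : nrm z <= 1 -> nrm (y * z) <= nrm y.
Proof. by move=> z1; have := nrmM y z; have := nrm_ge0 y; nra. Qed.

Lemma nrmM_le1l y z : nrm y <= 1 -> nrm (y * z) <= nrm z.
Proof. by move=> y1; have := nrmM y z; have := nrm_ge0 z; nra. Qed.

Lemma nrm_starM x : nrm (star x * x) = nrm x ^+ 2.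
Proof. by apply: (@complexI R); rewrite rmorphXn /= -!nrmE cstar_normE. Qed.

Lemma starK x : star (star x) = x. Proof. exact: cstar_starK. Qed.

Lemma starD x y : star (x + y) = star x + star y.
Proof. exact: cstar_starD. Qed.

Lemma starM x y : star (x * y) = star y * star x.
Proof. exact: cstar_starM. Qed.

Lemma starZ (a : R[i]) x : star (a *: x) = a^* *: star x.
Proof. exact: cstar_starZ. Qed.

Lemma star0 : star (0 : A) = 0.
Proof. by apply: (addrI (star 0)); rewrite -starD !addr0. Qed.

Lemma starN x : star (- x) = - star x.
Proof. by apply/eqP; rewrite -addr_eq0 -starD addNr star0. Qed.

Lemma starB x y : star (x - y) = star x - star y.
Proof. by rewrite starD starN. Qed.

Lemma star1 : star (1 : A) = 1.
Proof. by rewrite -[LHS]mulr1 -[X in _ * X]starK -starM mulr1 starK. Qed.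

Lemma starX x n : star (x ^+ n) = star x ^+ n.
Proof. by elim: n => [|n ih]; rewrite ?star1// exprS exprSr starM ih. Qed.

Lemma nrm_star x : nrm (star x) = nrm x.
Proof.
have le y : nrm (star y) <= nrm y.
  have := nrmM y (star y); rewrite -[X in X * star y]starK nrm_starM expr2.
  have [->|n0] := eqVneq (nrm (star y)) 0; first by rewrite nrm_ge0.
  by rewrite ler_pM2r// lt_neqAle eq_sym n0 nrm_ge0.
by apply/eqP; rewrite eq_le le -[X in nrm X <= _]starK le.
Qed.

Lemma nrm_isometryM s x : isometry_element s -> nrm (s * x) = nrm x.
Proof.
move=> h; apply/eqP; rewrite -(eqrXn2 (n := 2))// ?nrm_ge0//.
by rewrite -!nrm_starM starM mulrA -(mulrA (star x)) h mulr1.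
Qed.

Lemma nrm1 : nrm 1 = 1.
Proof.
have := nrm_starM 1; rewrite star1 mul1r expr2 => /eqP.
rewrite -subr_eq0 -[X in X - _]mulr1 -mulrBr mulf_eq0 => /orP[/eqP/nrm0_eq0/eqP|].
  by rewrite oner_eq0.
by rewrite subr_eq0 => /eqP.
Qed.

Lemma nrm_isometry s : isometry_element s -> nrm s = 1.
Proof. by move=> h; rewrite -[s]mulr1 nrm_isometryM// nrm1. Qed.

Lemma cauchy_limit (u : nat -> A) :
  (forall e : R, 0 < e -> exists N, forall n, (N <= n)%N -> nrm (u N - u n) < e) ->
  exists y, forall e : R, 0 < e -> exists N, forall n, (N <= n)%N -> nrm (y - u n) < e.
Proof.
move=> cu.
have R_of (e : R[i]) : 0 < e -> exists2 r : R, 0 < r & e = r%:C%C.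
  move=> e0; exists (complex.Re e).
    by rewrite -ltcR RRe_real// ger0_real// ltW.
  by rewrite RRe_real// ger0_real// ltW.
have : cvg (u @ \oo).
  apply/cauchy_cvgP/cauchy_exP => e /R_of[r r0 ->].
  have [N hN] := cu _ r0; exists (u N); exists N => // n /= Nn.
  by rewrite -ball_normE/= nrmE ltcR hN.
move=> /cvgrPdist_lt cl; exists (lim (u @ \oo)) => e e0.
have [|N _ hN] := cl e%:C%C; first by rewrite ltcR.
by exists N => n /hN /=; rewrite nrmE ltcR.
Qed.

Lemma nrm_triangle x y z : nrm (x - z) <= nrm (x - y) + nrm (y - z).
Proof. by rewrite (_ : x - z = (x - y) + (y - z)) ?nrmD// addrA subrK. Qed.

(** The solution [y = 1 - sqrt (1 - x)] of [(1 - y)^2 = 1 - x], obtained without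
power series: [y |-> (x + y^2) / 2] maps the ball of radius [q] to itself and
contracts distances by [q]. *)
Lemma half_square_fixpoint x (q : R) : nrm x <= q -> q < 1 ->
  exists2 y, nrm y <= q & y = 2^-1 *: (x + y * y).
Proof.
move=> xq q1; have q0 : 0 <= q by apply: le_trans (nrm_ge0 x) xq.
pose f (y : A) : A := 2^-1 *: (x + y * y).
have fq y : nrm y <= q -> nrm (f y) <= q.
  move=> yq; rewrite nrm_half; have := nrmD x (y * y); have := nrmM y y.
  have := nrm_ge0 y; nra.
have fl y z : nrm y <= q -> nrm z <= q -> nrm (f y - f z) <= q * nrm (y - z).
  move=> yq zq; rewrite /f -scalerBr nrm_half opprD addrACA subrr add0r.
  have -> : y * y - z * z = y * (y - z) + (y - z) * z.
    by rewrite mulrBr mulrBl addrA subrK.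
  have := nrmD (y * (y - z)) ((y - z) * z).
  have := nrmM y (y - z); have := nrmM (y - z) z; have := nrm_ge0 (y - z).
  have := nrm_ge0 y; have := nrm_ge0 z; nra.
pose u n := iter n f 0.
have uq n : nrm (u n) <= q by elim: n => [|n ih]; [rewrite nrm0 | apply: fq].
have ud n : nrm (u n - u n.+1) <= q ^+ n.
  elim: n => [|n ih]; first by rewrite sub0r nrmN (le_trans (uq _))// ltW.
  have := fl _ _ (uq n) (uq n.+1); rewrite -/(u n.+1) -/(u n.+2) exprS; nra.
have udist n m : (1 - q) * nrm (u n - u (n + m)%N) <= q ^+ n - q ^+ (n + m).
  elim: m => [|m ih]; first by rewrite addn0 !subrr nrm0 mulr0.
  have := nrm_triangle (u n) (u (n + m)%N) (u (n + m.+1)%N).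
  have := ud (n + m)%N; rewrite addnS exprS.
  have : 0 <= 1 - q by lra.
  by nra.
have [e e0|y yl] := cauchy_limit (u := u).
  have : q ^+ n @[n --> \oo] --> 0 by apply: cvg_expr; rewrite ger0_norm.
  move/cvgrPdist_lt => /(_ ((1 - q) * e)) []; first by rewrite mulr_gt0// subr_gt0.
  move=> N _ /(_ N (leqnn N)) /=; rewrite sub0r normrN ger0_norm ?exprn_ge0// => qN.
  exists N => n Nn; have := udist N (n - N)%N; rewrite subnKC// => h.
  have : 0 <= q ^+ n by apply: exprn_ge0.
  by have : 0 < 1 - q by [lra]; nra.
have yq : nrm y <= q.
  apply/ler_addgt0Pr => e /yl[N /(_ N (leqnn N)) h].
  by have := nrmD (y - u N) (u N); rewrite subrK; have := uq N; lra.
exists y => //; rewrite -/(f y); apply/eqP; rewrite -subr_eq0; apply/eqP/nrm0_eq0.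
apply/eqP; rewrite eq_le nrm_ge0 andbT; apply/ler_addgt0Pr => e e0.
have [|N hN] := yl (e / 2); first by rewrite divr_gt0.
have := hN N (leqnn N); have := hN N.+1 (leqnSn N).
have := nrm_triangle y (u N.+1) (f y); have := fl _ _ (uq N) yq.
by rewrite /= -/(u N) (nrmB (u N)); have := nrm_ge0 (y - u N); nra.
Qed.

Lemma half_square_fixpoint_unique x (q : R) y z : q < 1 ->
  nrm y <= q -> nrm z <= q ->
  y = 2^-1 *: (x + y * y) -> z = 2^-1 *: (x + z * z) -> y = z.
Proof.
move=> q1 yq zq ye ze; apply/subr0_eq/nrm0_eq0/eqP; rewrite eq_le nrm_ge0 andbT.
have : nrm (y - z) <= q * nrm (y - z).
  rewrite {1}ye {1}ze -scalerBr nrm_half opprD addrACA subrr add0r.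
  have -> : y * y - z * z = y * (y - z) + (y - z) * z.
    by rewrite mulrBr mulrBl addrA subrK.
  have := nrmD (y * (y - z)) ((y - z) * z).
  have := nrmM y (y - z); have := nrmM (y - z) z; have := nrm_ge0 (y - z).
  have := nrm_ge0 y; have := nrm_ge0 z; nra.
have := nrm_ge0 (y - z); nra.
Qed.

Lemma half_square_fixpoint_comm x (q : R) y h : q < 1 -> nrm y <= q ->
  y = 2^-1 *: (x + y * y) -> h * x = x * h -> h * y = y * h.
Proof.
move=> q1 yq ye hx; apply/subr0_eq/nrm0_eq0/eqP; rewrite eq_le nrm_ge0 andbT.
have : nrm (h * y - y * h) <= q * nrm (h * y - y * h).
  rewrite {1 2}ye -scalerAr -scalerAl -scalerBr nrm_half mulrDr mulrDl hx.
  rewrite opprD addrACA subrr add0r.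
  have -> : h * (y * y) - y * y * h = (h * y - y * h) * y + y * (h * y - y * h).
    by rewrite mulrBr mulrBl !mulrA addrA subrK.
  move: (h * y - y * h) => d.
  have := nrmD (d * y) (y * d); have := nrmM y d; have := nrmM d y.
  have := nrm_ge0 d; have := nrm_ge0 y; nra.
have := nrm_ge0 (h * y - y * h); nra.
Qed.

(** With [c = sqrt (1 - h^2)], which is selfadjoint and commutes with [h], the
element [h + i c] is a unitary whose real part is [h]. *)
Lemma contraction_unitary_average h : star h = h -> nrm h < 1 ->
  exists2 u, unitary_element u & h = 2^-1 *: (u + star u).
Proof.
move=> hs h1; have q1 : nrm h * nrm h < 1 by have := nrm_ge0 h; nra.
have [y yq ye] := half_square_fixpoint (nrmM h h) q1.
have ys : star y = y.
  have ysq : nrm (star y) <= nrm h * nrm h by rewrite nrm_star.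
  apply: (half_square_fixpoint_unique q1 ysq yq _ ye).
  by rewrite {1}ye starZ starD !starM hs fmorphV rmorph_nat.
have yh : h * y = y * h by apply: half_square_fixpoint_comm q1 yq ye _; rewrite mulrA.
pose c := 1 - y.
have cs : star c = c by rewrite starB star1 ys.
have ch : h * c = c * h by rewrite mulrBr mulrBl yh mulr1 mul1r.
have cc : h * h + c * c = 1.
  have y2 : y + y = h * h + y * y.
    by rewrite -mulr2n -scaler_nat {1}ye scalerA mulfV ?pnatr_eq0// scale1r.
  have -> : h * h = y + y - y * y by rewrite y2 addrK.
  rewrite /c mulrBr mulr1 mulrBl mul1r.
  by rewrite [1 - y + _]addrC opprB addrA subrKA addrK addrC subrK.
pose u := h + 'i *: c.
have us : star u = h - 'i *: c by rewrite starD hs starZ cs conjCi scaleNr.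
exists u; last first.
  have -> : u + star u = (2%:R : R[i]) *: h.
    by rewrite us addrACA subrr addr0 scaler_nat.
  by rewrite scalerA mulVf ?scale1r// pnatr_eq0.
have ii : ('i : R[i]) * 'i = -1 by rewrite -expr2 sqrCi.
split; rewrite us /u.
  rewrite mulrBl !mulrDr -!scalerAl -!scalerAr scalerA ii ch scaleN1r -cc.
  by rewrite opprB addrACA subrr addr0.
rewrite mulrDl !mulrBr -!scalerAl -!scalerAr scalerA ii ch scaleN1r -cc.
by rewrite opprK addrA subrK.
Qed.

Lemma nrm_range_proj_le1 s : isometry_element s -> nrm (s * star s) <= 1.
Proof.
by move=> hs; rewrite (le_trans (nrmM_le1r _ _))// ?nrm_star nrm_isometry.
Qed.

End Norm.

(** * Unital star-homomorphisms are contractive *)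

Section Contractive.
Variable R : realType.

Definition unital_star_hom (A B : cstarAlgType R) (f : A -> B) : Prop :=
  [/\ linear f, monoid_morphism f & {morph f : x / star x}].

(** A morphism sends unitaries to unitaries, so it sends selfadjoint strict
contractions, which are averages of two unitaries, to contractions; the
C*-identity extends the bound to all elements. *)
Lemma unital_star_hom_contractive (A B : cstarAlgType R) (f : A -> B) (x : A) :
  unital_star_hom f -> nrm (f x) <= nrm x.
Proof.
move=> [fl [f1 fM] fs].
have f0 : f 0 = 0 by have := fl (-1) 0 0; rewrite scaler0 addr0 scaleN1r addNr.
have fD y z : f (y + z) = f y + f z by have := fl 1 y z; rewrite !scale1r.
have fZ (a : R[i]) y : f (a *: y) = a *: f y by have := fl a y 0; rewrite f0 !addr0.
have f_le1 h : star h = h -> nrm h < 1 -> nrm (f h) <= 1.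
  move=> hs /(contraction_unitary_average hs)[u [u1 u2] ->].
  have fu : nrm (f u) = 1 by apply: nrm_isometry; rewrite /isometry_element -fs -fM u1.
  by rewrite fZ fD nrm_half; have := nrmD (f u) (f (star u)); rewrite fs nrm_star fu; lra.
have f_sa h : star h = h -> nrm (f h) <= nrm h.
  move=> hs; apply/ler_addgt0Pr => e e0.
  have r0 : 0 < nrm h + e by have := nrm_ge0 h; lra.
  have ra : `|((nrm h + e)^-1)%:C%C : R[i]| = ((nrm h + e)^-1)%:C%C.
    by rewrite ger0_norm// ler0c invr_ge0 ltW.
  have := f_le1 (((nrm h + e)^-1)%:C%C *: h).
  rewrite fZ (nrmZ h ra) (nrmZ (f h) ra) ![_^-1 * _]mulrC.
  rewrite ler_pdivrMr// ltr_pdivrMr// !mul1r; apply; last by rewrite ltrDl.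
  by rewrite starZ hs conj_Creal//; apply: ger0_real; rewrite ler0c invr_ge0 ltW.
have := f_sa (star x * x); rewrite starM starK fM fs !nrm_starM => /(_ erefl).
by rewrite ler_sqr ?nnegrE ?nrm_ge0.
Qed.

End Contractive.

(** * Closures of star-subalgebras *)

Section Closure.
Variables (R : realType) (A : cstarAlgType R).
Implicit Types (D M : set A) (x y z : A).

Lemma closure_nrmP D z :
  closure D z <-> forall e : R, 0 < e -> exists2 y, D y & nrm (z - y) < e.
Proof.
split=> [cl e e0|h B].
  have [|y [Dy /=]] := cl (ball z e%:C%C); first by apply: nbhsx_ballx; rewrite ltcR.
  by rewrite -ball_normE /= nrmE ltcR; exists y.
move=> /nbhs_ballP[e /= e0 zB].
have er : e = (complex.Re e)%:C%C by rewrite RRe_real// ger0_real// ltW.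
have [|y Dy zy] := h (complex.Re e); first by rewrite -ltcR -er.
exists y; split => //; apply: zB.
by rewrite -ball_normE /= nrmE er ltcR.
Qed.

Definition star_subalgebra M : Prop :=
  [/\ M 0 /\ (forall (a : R[i]) x y, M x -> M y -> M (a *: x + y)),
      forall x y, M x -> M y -> M (x * y)
    & forall x, M x -> M (star x)].

Lemma closure_star_subalgebra M :
  star_subalgebra M -> cstar_subalgebra (closure M).
Proof.
move=> [[M0 ML] MM MS]; split.
- exact: closed_closure.
- split; first exact: subset_closure.
  move=> a x y /closure_nrmP hx /closure_nrmP hy; apply/closure_nrmP => e e0.
  have ra : `|a| = (complex.Re `|a|)%:C%C by rewrite RRe_real// ger0_real.
  set r := complex.Re `|a| in ra.
  have r0 : 0 <= r by rewrite -lecR -ra normr_ge0.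
  have re : 0 < e / 2 / (1 + r) by rewrite !divr_gt0//; lra.
  have [x' Mx' xx] := hx _ re; have [|y' My' yy] := hy (e / 2); first by rewrite divr_gt0.
  exists (a *: x' + y'); first exact: ML.
  rewrite opprD addrACA -scalerBr.
  have := nrmD (a *: (x - x')) (y - y'); rewrite (nrmZ _ ra).
  move: xx; rewrite ltr_pdivlMr; last by lra.
  by have := nrm_ge0 (x - x'); nra.
- move=> x y /closure_nrmP hx /closure_nrmP hy; apply/closure_nrmP => e e0.
  have ny : 0 < e / 2 / (1 + nrm y) by have := nrm_ge0 y => ?; rewrite !divr_gt0//; lra.
  have [x' Mx' xx] := hx _ ny.
  have nx : 0 < e / 2 / (1 + nrm x') by have := nrm_ge0 x' => ?; rewrite !divr_gt0//; lra.
  have [y' My' yy] := hy _ nx.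
  exists (x' * y'); first exact: MM.
  have -> : x * y - x' * y' = (x - x') * y + x' * (y - y').
    by rewrite mulrBl mulrBr addrA subrK.
  have := nrmD ((x - x') * y) (x' * (y - y')).
  have := nrmM (x - x') y; have := nrmM x' (y - y').
  have := nrm_ge0 x'; have := nrm_ge0 y => y0 x0.
  have p1 : 0 < 1 + nrm y by lra.
  have p2 : 0 < 1 + nrm x' by lra.
  move: xx yy; rewrite (ltr_pdivlMr _ _ p1) (ltr_pdivlMr _ _ p2).
  by have := nrm_ge0 (x - x'); have := nrm_ge0 (y - y'); nra.
- move=> x /closure_nrmP hx; apply/closure_nrmP => e /hx[y My xy].
  by exists (star y); [exact: MS | rewrite -starB nrm_star].
Qed.

Lemma generated_sub_closure (E M : set A) :
  star_subalgebra M -> E `<=` M -> cstar_generated E `<=` closure M.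
Proof.
move=> /closure_star_subalgebra cM EM x; apply; split => //.
by move=> y /EM; exact: subset_closure.
Qed.

Lemma star_subalgebraD M x y : star_subalgebra M -> M x -> M y -> M (x + y).
Proof. by move=> [[_ ML] _ _] Mx My; rewrite -[x]scale1r; apply: ML. Qed.

Lemma star_subalgebraZ M (a : R[i]) x : star_subalgebra M -> M x -> M (a *: x).
Proof. by move=> [[M0 ML] _ _] Mx; rewrite -[_ *: _]addr0; apply: ML. Qed.

Lemma generated_cstar_subalgebra (E : set A) : cstar_subalgebra (cstar_generated E).
Proof.
split.
- apply: closed_bigI => //; by move=> D [[]].
- split=> [D [[_ [D0 _] _ _] _]//|a x y hx hy D [cD ED]].
  by have [_ [_ DL] _ _] := cD; apply: DL; [apply: hx | apply: hy].
- by move=> x y hx hy D [cD ED]; have [_ _ DM _] := cD; apply: DM; [apply: hx | apply: hy].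
- by move=> x hx D [cD ED]; have [_ _ _ DS] := cD; apply: DS; apply: hx.
Qed.

End Closure.

(** * The canonical shift of a Cuntz pair *)

Section StarHom.
Variables (R : realType) (A : cstarAlgType R) (f : A -> A).
Hypothesis hf : unital_star_hom f.

Lemma homM x y : f (x * y) = f x * f y. Proof. by case: hf => _ [_ ->]. Qed.
Lemma hom1 : f 1 = 1. Proof. by case: hf => _ []. Qed.
Lemma homS x : f (star x) = star (f x). Proof. by case: hf => _ _ ->. Qed.
Lemma homL (a : R[i]) x y : f (a *: x + y) = a *: f x + f y.
Proof. by case: hf => ->. Qed.
Lemma homD x y : f (x + y) = f x + f y.
Proof. by have := homL 1 x y; rewrite !scale1r. Qed.
Lemma hom0 : f 0 = 0. Proof. by apply: (addrI (f 0)); rewrite -homD !addr0. Qed.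
Lemma homZ (a : R[i]) x : f (a *: x) = a *: f x.
Proof. by rewrite -[a *: x]addr0 homL hom0 addr0. Qed.
Lemma hom_isometry x : isometry_element x -> isometry_element (f x).
Proof. by rewrite /isometry_element -homS -homM => ->; rewrite hom1. Qed.

Lemma iter_hom n : unital_star_hom (iter n f).
Proof.
elim: n => [|n [ihL [ih1 ihM] ihS]]; first by [].
split=> [a x y|/=|x /=]; first by rewrite /= ihL homL.
- by split=> [|x y] /=; rewrite ?ih1 ?ihM ?hom1 ?homM.
- by rewrite ihS homS.
Qed.

End StarHom.

Section CuntzShift.
Variables (R : realType) (A : cstarAlgType R).
Implicit Types s t z : A.

Definition cuntz_pair s t : Prop :=
  [/\ isometry_element s, isometry_element t & s * star s + t * star t = 1].

Definition cuntz_shift s t z : A := s * z * star s + t * z * star t.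

Lemma cuntz_pairC s t : cuntz_pair s t -> cuntz_pair t s.
Proof. by case=> *; split; rewrite // addrC. Qed.

Lemma cuntz_shiftC s t : cuntz_shift s t = cuntz_shift t s.
Proof. by apply/funext => z; rewrite /cuntz_shift addrC. Qed.

Lemma isometryX s n : isometry_element s -> isometry_element (s ^+ n).
Proof.
rewrite /isometry_element => ss; elim: n => [|n ih].
  by rewrite expr0 star1 mulr1.
by rewrite exprS starM mulrA -(mulrA (star _)) ss mulr1.
Qed.

(** Compressing [s star s + t star t = 1] by [s] leaves
[(star s t) (star s t)^star = 0]. *)
Lemma cuntz_orth s t : cuntz_pair s t -> star s * t = 0.
Proof.
move=> [ss tt st]; apply/nrm0_eq0; rewrite -nrm_star starM starK.
apply/eqP; rewrite -sqrf_eq0 -nrm_starM starM starK.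
suff -> : star s * t * (star t * s) = 0 by rewrite nrm0.
have : star s * (s * star s + t * star t) * s = 1 by rewrite st mulr1 ss.
rewrite mulrDr mulrDl !mulrA ss mul1r ss => h.
by apply: (addrI 1); rewrite h addr0.
Qed.

Variables (s t : A).
Hypothesis hst : cuntz_pair s t.
Local Notation phi := (cuntz_shift s t).

Lemma shiftMl z : phi z * s = s * z.
Proof.
have [ss tt st] := hst; have ts := cuntz_orth (cuntz_pairC hst).
by rewrite mulrDl -!mulrA ss ts !mulr0 addr0 mulr1.
Qed.

Lemma shift_star_hom : unital_star_hom phi.
Proof.
have [ss tt st] := hst; have sto := cuntz_orth hst.
have tso := cuntz_orth (cuntz_pairC hst).
split=> [a x y||x].
- by rewrite /phi !mulrDr !mulrDl -!scalerAr -!scalerAl scalerDr addrACA.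
- split=> [|x y]; first by rewrite /phi !mulr1.
  rewrite mulrDr; congr (_ + _).
    by rewrite !mulrA shiftMl.
  have e : phi x * t = t * x.
    by rewrite mulrDl -!mulrA sto tt !mulr0 add0r mulr1.
  by rewrite !mulrA e.
- by rewrite /phi starD !starM !starK !mulrA.
Qed.

(** The shift is the inner endomorphism that the isometries implement. *)
Lemma iter_shiftMl n z : iter n phi z * s ^+ n = s ^+ n * z.
Proof.
elim: n => [|n ih]; first by rewrite expr0 mulr1 mul1r.
by rewrite exprS mulrA /= shiftMl -mulrA ih mulrA.
Qed.

Lemma iter_shiftMr n z : star s ^+ n * iter n phi z = z * star s ^+ n.
Proof.
have := congr1 (@star R A) (iter_shiftMl n (star z)).
by rewrite !starM -(homS (iter_hom shift_star_hom n)) !starK !starX.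
Qed.

(** The unitary by which [w] fails to be invariant under the [n]-th power of the
shift. *)
Definition shift_cocycle (w : A) n : A := w * iter n phi (star w).

Lemma shift_cocycleK w n : unitary_element w -> w = shift_cocycle w n * iter n phi w.
Proof.
have hn := iter_hom shift_star_hom n.
by case=> u1 _; rewrite /shift_cocycle -mulrA -(homM hn) u1 (hom1 hn) mulr1.
Qed.

Lemma shift_cocycle_unitary w n :
  unitary_element w -> unitary_element (shift_cocycle w n).
Proof.
have hn := iter_hom shift_star_hom n.
case=> u1 u2; split; rewrite /shift_cocycle starM -(homS hn) starK.
  by rewrite mulrA -(mulrA _ (star w)) u1 mulr1 -(homM hn) u2 (hom1 hn).
by rewrite mulrA -(mulrA w) -(homM hn) u1 (hom1 hn) mulr1 u2.
Qed.

End CuntzShift.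

(** * Gauge-invariant elements of graded algebras *)

Section Expi.
Variable R : realType.
Implicit Types x y : R.

Lemma expiD x y : expi (x + y) = expi x * expi y.
Proof. by apply/eqP; rewrite eq_complex /= cosD sinD addrC eqxx /= addrC. Qed.

Lemma expiN x : expi (- x) = (expi x)^*.
Proof. by apply/eqP; rewrite eq_complex /= cosN sinN !eqxx. Qed.

Lemma expi0 : expi (0 : R) = 1.
Proof. by rewrite /expi cos0 sin0. Qed.

Lemma expiMn x n : expi (x *+ n) = expi x ^+ n.
Proof. by elim: n => [|n ih]; rewrite ?expi0// mulrS expiD ih exprS. Qed.

Lemma expi_pi : expi (pi : R) = -1.
Proof. by apply/eqP; rewrite eq_complex /= cospi sinpi oppr0 !eqxx. Qed.

Lemma expi_norm x : (expi x)^* * expi x = 1.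
Proof. by rewrite -expiN -expiD addNr expi0. Qed.

(** A rotation by [pi / (e - d)] negates the part of degree [e - d]; averaging
with it kills that part. *)
Lemma expi_degree_neg (d e : nat) : d != e ->
  exists theta : R, ((expi theta)^* ^+ d) * expi theta ^+ e = -1.
Proof.
move=> de; have n0 : (e%:R - d%:R : R) != 0 by rewrite subr_eq0 eqr_nat eq_sym.
exists (pi / (e%:R - d%:R)); set t := pi / _.
rewrite -expiN -!expiMn -expiD mulNrn addrC -(mulr_natr t e) -(mulr_natr t d).
by rewrite -mulrBr divfK// expi_pi.
Qed.

End Expi.

Section Graded.
Variables (R : realType) (A : cstarAlgType R) (s t : A).
Hypothesis hst : cuntz_pair s t.
Local Notation phi := (cuntz_shift s t).
Variable alpha : R -> {lrmorphism A -> A}.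
Hypothesis alphaS : forall theta, star_preserving (alpha theta).
Hypothesis alpha_s : forall theta, alpha theta s = expi theta *: s.
Variable B : set A.
Hypothesis Bsub : star_subalgebra B.
Hypothesis Bfix : B `<=` fixed_points alpha.
Hypothesis Bshift : forall b, B b -> B (phi b).
Hypothesis Bcorner : forall b, B b -> B (star s * b * s).
Hypothesis Bproj : B (s * star s).

(** The parts [star s^d B s^e], of gauge degree [e - d], generalize the words of
the Cuntz algebra.  They multiply among themselves because [s] can be moved
across [B]: [s b = phi b s]. *)
Definition graded_piece : set A :=
  [set x | exists d e b, B b /\ x = star s ^+ d * b * s ^+ e].

(** The number of terms is recorded because the expectation below removes the
terms one at a time. *)
Inductive graded_sum : nat -> A -> Prop :=
| GradedNil : graded_sum 0 0
| GradedCons n x y : graded_piece x -> graded_sum n y -> graded_sum n.+1 (x + y).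

Definition graded_span : set A := [set x | exists n, graded_sum n x].

Let BM x y : B x -> B y -> B (x * y). Proof. by case: Bsub => _ + _; apply. Qed.
Let BS x : B x -> B (star x). Proof. by case: Bsub => _ _; apply. Qed.

Lemma corner_iter n b : B b -> B (star s ^+ n * b * s ^+ n).
Proof.
elim: n b => [|n ih] b Bb; first by rewrite !expr0 mulr1 mul1r.
have -> : star s ^+ n.+1 * b * s ^+ n.+1 = star s ^+ n * (star s * b * s) * s ^+ n.
  by rewrite exprSr exprS !mulrA.
by apply: ih; apply: Bcorner.
Qed.

Lemma shift_iter n b : B b -> B (iter n phi b).
Proof. by move=> Bb; elim: n => //= n; exact: Bshift. Qed.

(** The case [n = 0] is [1 = star s (s star s) s]. *)
Lemma range_proj n : B (s ^+ n * star s ^+ n).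
Proof.
have [ss _ _] := hst; elim: n => [|n ih].
  by have := Bcorner Bproj; rewrite !mulrA ss mul1r ss expr0 mulr1.
rewrite exprSr (exprS (star s)) mulrA -(mulrA (s ^+ n)) -(iter_shiftMl hst).
by rewrite -mulrA; apply: BM => //; apply: shift_iter.
Qed.

(** The middle factor [s^e star s^d'] is a range projection in [B] times a power
of [s] or of [star s], which is then moved outwards across [B]. *)
Lemma graded_pieceM x y : graded_piece x -> graded_piece y -> graded_piece (x * y).
Proof.
move=> [d [e [b [Bb ->]]]] [d' [e' [b' [Bb' ->]]]].
have [le|/ltnW le] := leqP d' e.
  exists d, (e - d' + e')%N.
  exists (b * iter (e - d') phi (s ^+ d' * star s ^+ d' * b')); split.
    by apply: BM => //; apply: shift_iter; apply: BM => //; apply: range_proj.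
  rewrite -[in LHS](subnK le) !exprD !mulrA; congr (_ * _).
  by rewrite -!mulrA (iter_shiftMl hst) !mulrA.
exists (d + (d' - e))%N, e'.
exists (iter (d' - e) phi (b * (s ^+ e * star s ^+ e)) * b'); split.
  by apply: BM => //; apply: shift_iter; apply: BM => //; apply: range_proj.
rewrite -[in LHS](subnKC le) !exprD !mulrA; congr (_ * _ * _).
by rewrite -(mulrA (star s ^+ d) (star s ^+ _)) (iter_shiftMr hst) !mulrA.
Qed.

Lemma graded_pieceS x : graded_piece x -> graded_piece (star x).
Proof.
move=> [d [e [b [Bb ->]]]]; exists e, d, (star b); split; first exact: BS.
by rewrite !starM !starX starK mulrA.
Qed.

Lemma graded_pieceZ (a : R[i]) x : graded_piece x -> graded_piece (a *: x).
Proof.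
move=> [d [e [b [Bb ->]]]]; exists d, e, (a *: b); split.
  exact: star_subalgebraZ.
by rewrite -scalerAr scalerAl.
Qed.

Lemma graded_sumD n m x y :
  graded_sum n x -> graded_sum m y -> graded_span (x + y).
Proof.
move=> hx; elim: hx m y => [|k g z hg _ ih] m y hy; first by rewrite add0r; exists m.
have [j hj] := ih m y hy; exists j.+1; rewrite -addrA; exact: GradedCons.
Qed.

Lemma graded_sumZ (a : R[i]) n x : graded_sum n x -> graded_sum n (a *: x).
Proof.
elim=> [|k g z hg _ ih]; first by rewrite scaler0; exact: GradedNil.
by rewrite scalerDr; apply: GradedCons => //; apply: graded_pieceZ.
Qed.

Lemma graded_piece_span x : graded_piece x -> graded_span x.
Proof.
by move=> hx; exists 1; rewrite -[x]addr0; apply: GradedCons => //; exact: GradedNil.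
Qed.

Lemma graded_span_subalgebra : star_subalgebra graded_span.
Proof.
split.
- split; first by exists 0; exact: GradedNil.
  by move=> a x y [n hx] [m hy]; apply: graded_sumD hy; apply: graded_sumZ hx.
- have mul1 g n y : graded_piece g -> graded_sum n y -> graded_sum n (g * y).
    move=> hg; elim=> [|k g' z hg' _ ih]; first by rewrite mulr0; exact: GradedNil.
    by rewrite mulrDr; apply: GradedCons => //; apply: graded_pieceM.
  move=> x y [n hx] [m hy]; elim: hx => [|k g z hg _ [j ih]].
    by rewrite mul0r; exists 0; exact: GradedNil.
  by rewrite mulrDl; apply: graded_sumD ih; apply: mul1 hy.
- move=> x [n hx]; exists n; elim: hx => [|k g z hg _ ih].
    by rewrite star0; exact: GradedNil.
  by rewrite starD; apply: GradedCons => //; apply: graded_pieceS.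
Qed.

Lemma graded_sum0_span b : B b -> graded_span b.
Proof.
move=> Bb; apply: graded_piece_span; exists 0, 0, b.
by rewrite !expr0 mulr1 mul1r.
Qed.

Lemma gauge_homogeneous theta d e b : B b ->
  alpha theta (star s ^+ d * b * s ^+ e) =
  ((expi theta)^* ^+ d * expi theta ^+ e) *: (star s ^+ d * b * s ^+ e).
Proof.
move=> Bb; rewrite !rmorphM !rmorphXn /= alphaS alpha_s (Bfix Bb).
by rewrite starZ !exprZn -!scalerAl -scalerAr scalerA.
Qed.

Lemma graded_sum_average theta n x : graded_sum n x ->
  graded_sum n (2^-1 *: (x + alpha theta x)).
Proof.
elim=> [|k g z [d [e [b [Bb ->]]]] _ ih].
  by rewrite rmorph0 addr0 scaler0; exact: GradedNil.
rewrite rmorphD /= addrACA scalerDr; apply: GradedCons => //.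
rewrite gauge_homogeneous// -[X in X + _]scale1r -scalerDl scalerA.
by apply: graded_pieceZ; exists d, e, b.
Qed.

(** An approximation by a graded sum can be replaced by one of degree 0 that is at
least as good: for each term of nonzero degree, average the identity with a
gauge automorphism that negates this term.  The average fixes [z] and [B],
rescales the other terms and does not increase the norm. *)
Lemma graded_expectation n x z a : graded_sum n x ->
  fixed_points alpha z -> B a ->
  exists2 b, B b & nrm (z - b) <= nrm (z - (a + x)).
Proof.
move=> hx hz; move: n x hx a; elim=> [|n ih] x hx a Ba.
  by inversion hx; exists a; rewrite ?addr0.
inversion hx as [|m g y hg hy]; subst; case: hg => d [e [b [Bb ge]]].
have [de|de] := eqVneq d e.
  have [|b' Bb' h] := ih y hy (a + g).
    by apply: star_subalgebraD => //; rewrite ge -de; apply: corner_iter.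
  by exists b' => //; rewrite addrA.
(* This average kills [g] and leaves an approximation with fewer terms. *)
have [theta ht] := expi_degree_neg R de.
have [b' Bb' h] := ih _ (graded_sum_average theta hy) a Ba.
exists b' => //; apply: le_trans h _.
pose T (v : A) : A := 2^-1 *: (v + alpha theta v).
have Tfix v : alpha theta v = v -> T v = v.
  move=> h; rewrite /T h -mulr2n -(scaler_nat 2 v) scalerA mulVf ?scale1r//.
have TD u v : T (u + v) = T u + T v.
  by rewrite /T rmorphD /= addrACA scalerDr.
have TB u v : T (u - v) = T u - T v.
  by rewrite /T rmorphB /= addrACA -opprD scalerBr.
have Tg : T g = 0.
  by rewrite /T ge gauge_homogeneous// ht scaleN1r subrr scaler0.
have -> : z - (a + 2^-1 *: (y + alpha theta y)) = T (z - (a + (g + y))).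
  by rewrite TB !TD Tg add0r (Tfix z (hz _)) (Tfix a (Bfix Ba _)).
move: (z - _) => v; rewrite /T nrm_half; have := nrmD v (alpha theta v).
have : nrm (alpha theta v) <= nrm v.
  apply: unital_star_hom_contractive; split; [exact: linearP| |exact: alphaS].
  by split; [exact: rmorph1 | exact: rmorphM].
by lra.
Qed.

Lemma graded_fixed_closure z :
  closure graded_span z -> fixed_points alpha z -> closure B z.
Proof.
move=> /closure_nrmP hz fz; apply/closure_nrmP => e /hz[x [n hx] zx].
have B0 : B 0 by case: Bsub => [[]].
have [b Bb zb] := graded_expectation hx fz B0.
by exists b => //; apply: le_lt_trans zb _; rewrite add0r.
Qed.

End Graded.

(** * The odometer relations *)

Section Odometer.
Variables (R : realType) (A : cstarAlgType R).
Implicit Types (U s t x y z : A).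

(** [U] adds 1 to a binary integer whose lowest digit is 0 on the range of [s]
and 1 on the range of [t]; the last two equations are addition without and with
a carry.  Unlike the defining relations of the algebra, this form is symmetric
under [odometer_flip]. *)
Definition odometer_relations U s t : Prop :=
  [/\ cuntz_pair s t, unitary_element U, U * s = t & U * t = s * U].

Lemma Q2_odometer U s : Q2_relations U s -> odometer_relations U s (U * s).
Proof.
move=> [[u1 u2] ss sU st]; split => //.
- split => //; first by rewrite /isometry_element starM mulrA -(mulrA (star s)) u1 mulr1.
  by rewrite starM !mulrA.
- by rewrite mulrA -expr2 sU.
Qed.

(** Complementing all digits turns adding 1 into subtracting 1. *)
Lemma odometer_flip U s t :
  odometer_relations U s t -> odometer_relations (star U) t s.
Proof.
move=> [hst [u1 u2] Us Ut]; split.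
- exact: cuntz_pairC.
- by split; rewrite starK.
- by rewrite -Us mulrA u1 mul1r.
- by rewrite -Us -[s in LHS]mulr1 -u2 -!mulrA (mulrA s) -Ut -Us !mulrA u1 mul1r.
Qed.

Lemma odometer_shift U s t : odometer_relations U s t -> cuntz_shift s t U = U * U.
Proof.
move=> [[_ _ st] _ Us Ut].
by rewrite -[RHS]mulr1 -st mulrDr !mulrA -(mulrA U U s) Us Ut -(mulrA U U t) Ut mulrA Us.
Qed.

(** Adding 1 either changes the lowest digit 0 to 1 or changes it from 1 to 0 and
carries to the next digits, on which [phi U] acts. *)
Lemma odometer_carry U s t : odometer_relations U s t ->
  U = t * star s + s * star t * cuntz_shift s t U.
Proof.
move=> [hst _ Us Ut]; have [ss tt st] := hst.
rewrite mulrDr !mulrA -(mulrA s (star t) s) (cuntz_orth (cuntz_pairC hst)).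
rewrite mulr0 !mul0r add0r -(mulrA s (star t) t) tt mulr1.
by rewrite -[LHS]mulr1 -st mulrDr !mulrA Us Ut.
Qed.

End Odometer.

(** * Approximation of gauge-invariant elements *)

Section Core.
Variables (R : realType) (A : cstarAlgType R) (U s t : A).
Hypothesis hU : odometer_relations U s t.
Variable alpha : R -> {lrmorphism A -> A}.
Hypothesis alphaS : forall theta, star_preserving (alpha theta).
Hypothesis alpha_s : forall theta, alpha theta s = expi theta *: s.
Hypothesis alpha_U : forall theta, alpha theta U = U.
Variable O : set A.
Hypothesis Osub : cstar_subalgebra O.
Hypothesis Os : O s.
Hypothesis Ot : O t.
Local Notation phi := (cuntz_shift s t).

Let hst : cuntz_pair s t. Proof. by case: hU. Qed.
Let phi_hom : unital_star_hom phi. Proof. exact: shift_star_hom. Qed.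
Let OD x y : O x -> O y -> O (x + y).
Proof. by case: Osub => _ [_ OL] _ _ Ox Oy; rewrite -[x]scale1r; apply: OL. Qed.
Let OM x y : O x -> O y -> O (x * y). Proof. by case: Osub => _ _ + _; apply. Qed.
Let OS x : O x -> O (star x). Proof. by case: Osub => _ _ _; apply. Qed.

Definition gauge_core : set A := O `&` fixed_points alpha.

Lemma alpha_hom theta : unital_star_hom (alpha theta).
Proof.
split; [exact: linearP| |exact: alphaS].
by split; [exact: rmorph1 | exact: rmorphM].
Qed.

Lemma alpha_t theta : alpha theta t = expi theta *: t.
Proof.
have [_ _ <- _] := hU.
by rewrite rmorphM /= alpha_s alpha_U scalerAr.
Qed.

Lemma gauge_invariant_word x y z theta :
  alpha theta x = expi theta *: x -> alpha theta y = expi theta *: y ->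
  alpha theta z = z -> alpha theta (x * z * star y) = x * z * star y.
Proof.
move=> hx hy hz; rewrite !rmorphM /= alphaS hx hy hz starZ.
by rewrite -!scalerAl -scalerAr scalerA mulrC expi_norm scale1r.
Qed.

Lemma fixed_shift z : fixed_points alpha z -> fixed_points alpha (phi z).
Proof.
by move=> fz theta; rewrite rmorphD /= !gauge_invariant_word// alpha_t.
Qed.

Lemma gauge_core_subalgebra : star_subalgebra gauge_core.
Proof.
have [_ [ZO LO] _ _] := Osub; split.
- split; first by split=> // theta; rewrite rmorph0.
  move=> a x y [Ox fx] [Oy fy]; split; first exact: LO.
  by move=> theta; rewrite (homL (alpha_hom theta)) fx fy.
- move=> x y [Ox fx] [Oy fy]; split; first exact: OM.
  by move=> theta; rewrite rmorphM /= fx fy.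
- move=> x [Ox fx]; split; first exact: OS.
  by move=> theta; rewrite alphaS fx.
Qed.

Lemma gauge_core_shift x : gauge_core x -> gauge_core (phi x).
Proof.
move=> [Ox fx]; split; last exact: fixed_shift.
by apply: OD; apply: OM; [exact: OM|exact: OS|exact: OM|exact: OS].
Qed.

(** For the Cuntz algebra this plays the part of the span of the matrix units
[s_mu star s_nu] with words of length [n].  Defining it by commutation with the
range of [phi^n] makes its closure properties immediate. *)
Definition core_level n : set A :=
  [set y | gauge_core y /\ forall z, y * iter n phi z = iter n phi z * y].

Definition core_union : set A := [set y | exists n, core_level n y].

Lemma core_level_subalgebra n : star_subalgebra (core_level n).
Proof.
have [[F0 FL] FM FS] := gauge_core_subalgebra; split.
- split; first by split=> // z; rewrite mul0r mulr0.
  move=> a x y [Fx hx] [Fy hy]; split; first exact: FL.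
  by move=> z; rewrite mulrDl mulrDr -scalerAl -scalerAr hx hy.
- move=> x y [Fx hx] [Fy hy]; split; first exact: FM.
  by move=> z; rewrite -mulrA hy mulrA hx mulrA.
- move=> x [Fx hx]; split; first exact: FS.
  move=> z; apply: (can_inj (@starK _ _)); rewrite !starM starK.
  by rewrite -(homS (iter_hom phi_hom n)) hx.
Qed.

Lemma core_levelW n m y : (n <= m)%N -> core_level n y -> core_level m y.
Proof.
by move=> nm [Fy hy]; split=> // z; rewrite -(subnKC nm) iterD hy.
Qed.

Lemma core_level_shift n y : core_level n y -> core_level n.+1 (phi y).
Proof.
move=> [Fy hy]; split; first exact: gauge_core_shift.
by move=> z /=; rewrite -!(homM phi_hom) hy.
Qed.

Lemma core_level_iter n k y : core_level n y -> core_level (k + n) (iter k phi y).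
Proof. by move=> hy; elim: k => [//|k ih]; exact: core_level_shift. Qed.

Lemma core_level_corner n y : core_level n.+1 y -> core_level n (star s * y * s).
Proof.
move=> [[Oy fy] hy]; split.
  split; first by apply: OM => //; apply: OM => //; apply: OS.
  move=> theta; rewrite !rmorphM /= alphaS alpha_s fy starZ.
  by rewrite -scalerAr -!scalerAl scalerA mulrC expi_norm scale1r.
move=> z; have h1 := shiftMl hst (iter n phi z).
have h2 : star s * phi (iter n phi z) = iter n phi z * star s.
  exact: (iter_shiftMr hst 1 (iter n phi z)).
by rewrite -!mulrA -h1 (mulrA y) (hy z) /= !mulrA h2.
Qed.

(** Matrix units of length 1 involve only the lowest digit, and the shift acts on
the others. *)
Lemma matrix_unit_core x y : (x = s \/ x = t) -> (y = s \/ y = t) ->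
  core_level 1 (x * star y).
Proof.
move=> hx hy.
have word v : (v = s \/ v = t) -> [/\ O v, forall theta, alpha theta v = expi theta *: v
    & forall z, phi z * v = v * z].
  case=> ->; split => //; [exact: shiftMl| exact: alpha_t|].
  by rewrite cuntz_shiftC; apply: shiftMl; apply: cuntz_pairC.
have [Ox ax px] := word x hx; have [Oy ay py] := word y hy; split.
  split; first by apply: OM => //; apply: OS.
  by move=> theta; rewrite -[x]mulr1 gauge_invariant_word// rmorph1.
move=> z /=; rewrite mulrA px -!mulrA; congr (_ * _).
apply: (can_inj (@starK _ _)); rewrite !starM starK -(homS phi_hom).
exact: py.
Qed.

Lemma core_union_subalgebra : star_subalgebra core_union.
Proof.
split.
- split; first by exists 0; case: (core_level_subalgebra 0) => [[]].
  move=> a x y [n hx] [m hy]; exists (maxn n m).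
  have [[_ L] _ _] := core_level_subalgebra (maxn n m).
  by apply: L; [apply: core_levelW hx; lia | apply: core_levelW hy; lia].
- move=> x y [n hx] [m hy]; exists (maxn n m).
  have [_ M _] := core_level_subalgebra (maxn n m).
  by apply: M; [apply: core_levelW hx; lia | apply: core_levelW hy; lia].
- by move=> x [n hx]; exists n; have [_ _ S] := core_level_subalgebra n; apply: S.
Qed.

(** Laurent polynomials of degree at most 1 in the unitary [phi^n U], which adds
1 to the digits from the [n]-th on.  Degree 1 is enough: carrying passes from
level [n] to level [n + 1], and [phi^n(U)^2 = phi^(n+1)(U)]. *)
Definition laurent n : set A := [set z | exists c0 c1 c2,
  [/\ core_level n c0, core_level n c1, core_level n c2 &
      z = c0 + c1 * iter n phi U + c2 * iter n phi (star U)]].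

Definition laurent_union : set A := [set z | exists n, laurent n z].

Lemma core_level0 n : core_level n 0.
Proof. by case: (core_level_subalgebra n) => [[]]. Qed.

Lemma core_level1 : core_level 0 1.
Proof.
have [ss _ _] := hst.
have := @core_level_corner 0 _ (matrix_unit_core (or_introl erefl) (or_introl erefl)).
by rewrite !mulrA ss mul1r ss.
Qed.

Lemma core_laurent n c : core_level n c -> laurent n c.
Proof.
move=> hc; exists c, 0, 0; split => //; [exact: core_level0|exact: core_level0|].
by rewrite !mul0r !addr0.
Qed.

Lemma core_laurentU n c : core_level n c -> laurent n (c * iter n phi U).
Proof.
move=> hc; exists 0, c, 0; split => //; [exact: core_level0|exact: core_level0|].
by rewrite mul0r add0r addr0.
Qed.

Lemma core_laurentV n c : core_level n c -> laurent n (c * iter n phi (star U)).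
Proof.
move=> hc; exists 0, 0, c; split => //; [exact: core_level0|exact: core_level0|].
by rewrite mul0r !add0r.
Qed.

Lemma laurentL n (a : R[i]) x y : laurent n x -> laurent n y -> laurent n (a *: x + y).
Proof.
move=> [c0 [c1 [c2 [h0 h1 h2 ->]]]] [d0 [d1 [d2 [k0 k1 k2 ->]]]].
have [[_ L] _ _] := core_level_subalgebra n.
exists (a *: c0 + d0), (a *: c1 + d1), (a *: c2 + d2).
split; [exact: L|exact: L|exact: L|].
rewrite !scalerDr !scalerAl !mulrDl [LHS]addrACA; congr (_ + _).
by rewrite [LHS]addrACA.
Qed.

Lemma laurentD n x y : laurent n x -> laurent n y -> laurent n (x + y).
Proof. by move=> hx hy; rewrite -[x]scale1r; apply: laurentL. Qed.

Lemma laurent_succ n z : laurent n z -> laurent n.+1 z.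
Proof.
move=> [c0 [c1 [c2 [h0 h1 h2 ->]]]].
have [_ M _] := core_level_subalgebra n.+1.
have W c : core_level n c -> core_level n.+1 c by apply: core_levelW.
have hn := iter_hom phi_hom n.
have mu x y : (x = s \/ x = t) -> (y = s \/ y = t) ->
    core_level n.+1 (iter n phi (x * star y)).
  by move=> hx hy; rewrite -addn1; apply: core_level_iter; apply: matrix_unit_core.
have ts : core_level n.+1 (iter n phi (t * star s)) by apply: mu; [right|left].
have st : core_level n.+1 (iter n phi (s * star t)) by apply: mu; [left|right].
have h2' := core_laurentV (M _ _ (W _ h2) ts).
have h1' := core_laurentU (M _ _ (W _ h1) st).
have e1 : iter n phi U = iter n phi (t * star s) + iter n phi (s * star t) * iter n.+1 phi U.
  by rewrite iterSr -(homM hn) -(homD hn) -(odometer_carry hU).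
have e2 : iter n phi (star U) =
    iter n phi (s * star t) + iter n phi (t * star s) * iter n.+1 phi (star U).
  rewrite iterSr -(homM hn) -(homD hn) cuntz_shiftC.
  by rewrite -(odometer_carry (odometer_flip hU)).
have -> : c0 + c1 * iter n phi U + c2 * iter n phi (star U) =
    c0 + (c1 * iter n phi (t * star s) + c1 * iter n phi (s * star t) * iter n.+1 phi U)
       + (c2 * iter n phi (s * star t) + c2 * iter n phi (t * star s) * iter n.+1 phi (star U)).
  by rewrite e1 e2 (mulrDr c1) (mulrDr c2) (mulrA c1) (mulrA c2).
apply: laurentD; first (apply: laurentD; first by apply: core_laurent; apply: W).
all: by apply: laurentD => //; apply: core_laurent; apply: M => //; apply: W.
Qed.

Lemma laurentW n m z : (n <= m)%N -> laurent n z -> laurent m z.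
Proof.
move=> nm hz; rewrite -(subnK nm); elim: (m - n)%N => //= k ih.
exact: laurent_succ.
Qed.

Lemma laurent_unionD x y : laurent_union x -> laurent_union y -> laurent_union (x + y).
Proof.
move=> [n hx] [m hy]; exists (maxn n m).
by apply: laurentD; [apply: laurentW hx; lia | apply: laurentW hy; lia].
Qed.

Lemma core_comm n c z : core_level n c -> iter n phi z * c = c * iter n phi z.
Proof. by move=> [_ ->]. Qed.

(** The squares of [phi^n U] and of its inverse are linear at the next level, so
that the union of all levels is an algebra. *)
Lemma laurentM n x y : laurent n x -> laurent n y -> laurent n.+1 (x * y).
Proof.
move=> [c0 [c1 [c2 [h0 h1 h2 ->]]]] [d0 [d1 [d2 [k0 k1 k2 ->]]]].
have [_ M _] := core_level_subalgebra n.
have hn := iter_hom phi_hom n; have [_ [u1 u2] _ _] := hU.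
have W c : core_level n c -> core_level n.+1 c by apply: core_levelW.
have swap c d v v' : core_level n d ->
    c * iter n phi v * (d * iter n phi v') = c * d * iter n phi (v * v').
  by move=> hd; rewrite -!mulrA (mulrA _ d) (core_comm _ hd) (homM hn) !mulrA.
have swap0 c d v : core_level n d -> c * iter n phi v * d = c * d * iter n phi v.
  by move=> hd; rewrite -!mulrA (core_comm _ hd).
have uu : U * U = phi U by rewrite (odometer_shift hU).
have vv : star U * star U = phi (star U).
  by rewrite -(odometer_shift (odometer_flip hU)) cuntz_shiftC.
rewrite !mulrDl !mulrDr !swap// !swap0// !mulrA.
rewrite u1 u2 (hom1 hn) uu vv !mulr1 -!iterSr.
do ?[apply: laurentD]; do ?[by apply: core_laurentU; apply: W; apply: M
  | by apply: core_laurentV; apply: W; apply: M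
  | by apply: core_laurent; apply: W; apply: M
  | by apply: laurent_succ; apply: core_laurentU; apply: M
  | by apply: laurent_succ; apply: core_laurentV; apply: M].
Qed.

Lemma laurent_union_subalgebra : star_subalgebra laurent_union.
Proof.
split.
- split; first by exists 0; apply: core_laurent; exact: core_level0.
  move=> a x y [n hx] hy; apply: laurent_unionD => //; exists n.
  by rewrite -[_ *: _]addr0; apply: laurentL => //; apply: core_laurent; exact: core_level0.
- move=> x y [n hx] [m hy]; exists (maxn n m).+1.
  by apply: laurentM; [apply: laurentW hx; lia | apply: laurentW hy; lia].
- move=> x [n [c0 [c1 [c2 [h0 h1 h2 ->]]]]]; exists n.
  have [_ _ S] := core_level_subalgebra n; have hn := iter_hom phi_hom n.
  exists (star c0), (star c2), (star c1); split; [exact: S|exact: S|exact: S|].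
  rewrite !starD !starM -!(homS hn) starK -addrA [X in _ + X]addrC addrA.
  by rewrite !core_comm//; apply: S.
Qed.

Lemma laurent_shift z : laurent_union z -> laurent_union (phi z).
Proof.
move=> [n [c0 [c1 [c2 [h0 h1 h2 ->]]]]]; exists n.+1.
exists (phi c0), (phi c1), (phi c2).
split; [exact: core_level_shift|exact: core_level_shift|exact: core_level_shift|].
by rewrite !(homD phi_hom) !(homM phi_hom).
Qed.

Lemma laurent_corner z : laurent_union z -> laurent_union (star s * z * s).
Proof.
move=> [n /laurent_succ[c0 [c1 [c2 [h0 h1 h2 ->]]]]]; exists n.
exists (star s * c0 * s), (star s * c1 * s), (star s * c2 * s).
split; [exact: core_level_corner|exact: core_level_corner|exact: core_level_corner|].
have := shiftMl hst (iter n phi (star U)); have := shiftMl hst (iter n phi U).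
rewrite -!iterS; move: (iter n.+1 phi U) (iter n.+1 phi (star U)) => x y hx hy.
by rewrite !mulrDr !mulrDl -!mulrA hx hy.
Qed.

Lemma iter_fixed n z : fixed_points alpha z -> fixed_points alpha (iter n phi z).
Proof. by move=> fz; elim: n => //= n; exact: fixed_shift. Qed.

Lemma laurent_fixed : laurent_union `<=` fixed_points alpha.
Proof.
move=> z [n [c0 [c1 [c2 [[[_ f0] _] [[_ f1] _] [[_ f2] _] ->]]]]] theta.
have fU : fixed_points alpha U by [].
have fV : fixed_points alpha (star U) by move=> th; rewrite alphaS alpha_U.
by rewrite !rmorphD !rmorphM /= f0 f1 f2 (iter_fixed n fU) (iter_fixed n fV).
Qed.

(** [t = (t star s) s] is homogeneous of degree 1, so the Cuntz algebra is graded
over its core. *)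
Lemma core_union_approx z : cstar_generated [set t; s] z ->
  fixed_points alpha z -> closure core_union z.
Proof.
move=> hz fz.
have Bsub := core_union_subalgebra.
have Bfix : core_union `<=` fixed_points alpha by move=> y [n [[]]].
have Bshift y : core_union y -> core_union (phi y).
  by move=> [n hy]; exists n.+1; exact: core_level_shift.
have Bcorner y : core_union y -> core_union (star s * y * s).
  by move=> [n hy]; exists n; apply: core_level_corner; apply: core_levelW hy.
have mu x y : (x = s \/ x = t) -> (y = s \/ y = t) -> core_union (x * star y).
  by move=> hx hy; exists 1%N; apply: matrix_unit_core.
have Bproj : core_union (s * star s) by apply: mu; left.
apply: (graded_fixed_closure alphaS alpha_s Bsub) => //.
move: {fz} z hz; apply: generated_sub_closure.
  exact: (graded_span_subalgebra hst).
have [ss _ _] := hst.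
move=> _ [->|->].
  apply: graded_piece_span; exists 0, 1%N, (t * star s); split; first by apply: mu; [right|left].
  by rewrite expr0 mul1r expr1 -mulrA ss mulr1.
apply: graded_piece_span; exists 0, 1%N, (s * star s); split => //.
by rewrite expr0 mul1r expr1 -mulrA ss mulr1.
Qed.

Lemma laurent_approx z : cstar_generated [set U; s] z ->
  fixed_points alpha z -> closure laurent_union z.
Proof.
move=> hz fz.
have Bproj : laurent_union (s * star s).
  by exists 1%N; apply: core_laurent; apply: matrix_unit_core; left.
apply: (graded_fixed_closure alphaS alpha_s laurent_union_subalgebra) => //.
- exact: laurent_fixed.
- exact: laurent_corner.
move: {fz} z hz; apply: generated_sub_closure.
  apply: (graded_span_subalgebra hst) => //; 
    [exact: laurent_union_subalgebra|exact: laurent_shift|exact: laurent_corner].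
have [ss _ _] := hst.
move=> _ [->|->].
  apply: graded_sum0_span; exists 0; rewrite -[U]mul1r.
  exact: (core_laurentU core_level1).
apply: graded_piece_span; exists 0, 1%N, (s * star s); split => //.
by rewrite expr0 mul1r expr1 -mulrA ss mulr1.
Qed.

(** Elements commuting with the range of [phi^m] commute with [phi^l q] as soon as
[m <= l], and they are dense. *)
Lemma core_asymptotically_central z q (e : R) : cstar_generated [set t; s] z ->
  fixed_points alpha z -> nrm q <= 1 -> 0 < e ->
  exists m, forall l, (m <= l)%N ->
    nrm (iter l phi q * z - z * iter l phi q) <= e.
Proof.
move=> Oz fz q1 e0; have /closure_nrmP := core_union_approx Oz fz.
move=> /(_ (e / 2)) []; first by rewrite divr_gt0.
move=> y [m [_ hy]] zy; exists m => l ml.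
have p1 : nrm (iter l phi q) <= 1.
  by apply: le_trans (unital_star_hom_contractive _ (iter_hom phi_hom l)) q1.
have yp : y * iter l phi q = iter l phi q * y by rewrite -(subnKC ml) iterD hy.
have -> : iter l phi q * z - z * iter l phi q =
    iter l phi q * (z - y) - (z - y) * iter l phi q.
  by rewrite mulrBr mulrBl yp opprB addrA subrK.
have := nrmD (iter l phi q * (z - y)) (- ((z - y) * iter l phi q)).
by rewrite nrmN; have := nrmM_le1l (z - y) p1; have := nrmM_le1r (z - y) p1; lra.
Qed.

(** [w phi(star w)] is the sum of [(w s star w) star s] and [(w t star w) star t],
and the later cocycles are products of shifts of this one. *)
Lemma shift_cocycle_core w n : unitary_element w -> fixed_points alpha w ->
  (forall z, O z -> O (w * z * star w)) -> gauge_core (shift_cocycle s t w n).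
Proof.
move=> [u1 u2] fw hw; have [_ FM _] := gauge_core_subalgebra.
have fws : fixed_points alpha (star w) by move=> theta; rewrite alphaS fw.
have x1 : gauge_core (w * phi (star w)).
  split; last by move=> theta; rewrite rmorphM /= fw (fixed_shift fws).
  by rewrite /cuntz_shift mulrDr !mulrA; apply: OD; apply: OM;
    [exact: hw|exact: OS|exact: hw|exact: OS].
elim: n => [|n ih]; first by rewrite /shift_cocycle /= u2; case: core_level1.
have -> : shift_cocycle s t w n.+1 = w * phi (star w) * phi (shift_cocycle s t w n).
  by rewrite /shift_cocycle -mulrA -(homM phi_hom) /= mulrA u1 mul1r.
by apply: FM => //; apply: gauge_core_shift.
Qed.

End Core.

(** * The terms that connect the two halves vanish *)

Section OffDiagonal.
Variables (R : realType) (A : cstarAlgType R) (U s t : A).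
Hypothesis hU : odometer_relations U s t.
Local Notation phi := (cuntz_shift s t).
Variable w : A.
Hypothesis w_unitary : unitary_element w.
Local Notation x := (shift_cocycle s t w).

Definition digit_proj l : A := iter l phi (s * star s).

Hypothesis x_central : forall n (e : R), 0 < e -> exists m, forall l, (m <= l)%N ->
  nrm (digit_proj l * x n - x n * digit_proj l) <= e.

Let hst : cuntz_pair s t. Proof. by case: hU. Qed.
Let phi_hom n : unital_star_hom (iter n phi).
Proof. by apply: iter_hom; exact: shift_star_hom. Qed.

Lemma digit_proj_le1 l : nrm (digit_proj l) <= 1.
Proof.
have [ss _ _] := hst; apply: le_trans (unital_star_hom_contractive _ (phi_hom l)) _.
exact: nrm_range_proj_le1.
Qed.

Lemma shiftMl_t z : phi z * t = t * z.
Proof. by rewrite cuntz_shiftC; apply: shiftMl; apply: cuntz_pairC. Qed.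

Lemma digit_projD n l : digit_proj (n + l) = iter n phi (digit_proj l).
Proof. exact: iterD. Qed.

Lemma digit_proj_t l : digit_proj l * t ^+ l.+1 = 0.
Proof.
elim: l => [|l ih].
  by rewrite expr1 -mulrA (cuntz_orth hst) mulr0.
by rewrite exprS mulrA -[l.+1 in X in X * _]add1n digit_projD /= shiftMl_t -mulrA ih mulr0.
Qed.

Lemma digit_proj_s l : digit_proj l * s ^+ l.+1 = s ^+ l.+1.
Proof.
have [ss _ _] := hst; elim: l => [|l ih]; first by rewrite expr1 -mulrA ss mulr1.
rewrite [in LHS]exprS mulrA -[l.+1 in X in X * _]add1n digit_projD /= shiftMl//.
by rewrite -mulrA ih -exprS.
Qed.

Lemma digit_projSs l y : digit_proj l.+1 * (s * y) = s * (digit_proj l * y).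
Proof. by rewrite mulrA -[l.+1]add1n digit_projD /= shiftMl// mulrA. Qed.

Lemma digit_projSt l y : digit_proj l.+1 * (t * y) = t * (digit_proj l * y).
Proof. by rewrite mulrA -[l.+1]add1n digit_projD /= shiftMl_t mulrA. Qed.

Lemma odometer_starS : star U * s = t * star U.
Proof. by case: (odometer_flip hU). Qed.

Lemma odometer_starT : star U * t = s.
Proof. by case: (odometer_flip hU). Qed.

Lemma odometer_tX n : U * t ^+ n = s ^+ n * U.
Proof.
have [_ _ _ Ut] := hU.
by elim: n => [|n ih]; rewrite ?expr0 ?mulr1 ?mul1r// !exprS mulrA Ut -mulrA ih mulrA.
Qed.

Section Laurent.
Variables (n : nat) (c0 c1 c2 : A).
Hypothesis h0 : forall z, c0 * iter n phi z = iter n phi z * c0.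
Hypothesis h1 : forall z, c1 * iter n phi z = iter n phi z * c1.
Hypothesis h2 : forall z, c2 * iter n phi z = iter n phi z * c2.
Let b := c0 + c1 * iter n phi U + c2 * iter n phi (star U).

(** The coefficients commute with the range of [phi^n], so compressions from that
range act on [1], [U] and [star U] alone. *)
Lemma compressed_laurent y z : iter n phi y * b * iter n phi z =
  c0 * iter n phi (y * z) + c1 * iter n phi (y * (U * z)) + c2 * iter n phi (y * (star U * z)).
Proof.
rewrite /b !(homM (phi_hom n)).
move: (h0 y) (h1 y) (h2 y); move: (iter n phi y) (iter n phi z) => v v' k0 k1 k2.
by rewrite !mulrDr !mulrDl !mulrA -k0 -k1 -k2.
Qed.

(** From the [n]-th digit on, the word [s^(n+1) t^(l+1)] is a 0 followed by ones;
adding 1, 0 or -1 there leaves its last digit, the one tested, equal to 1. *)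
Lemma laurent_kill l : (0 < l)%N ->
  digit_proj (n.+1 + l) * b * (s ^+ n.+1 * t ^+ l.+1) = 0.
Proof.
case: l => // l _.
have [_ _ Us _] := hU.
rewrite exprSr -(mulrA (s ^+ n)) -(iter_shiftMl hst) addSnnS digit_projD.
rewrite [_ * (iter _ _ _ * _)]mulrA compressed_laurent.
rewrite digit_projSs digit_proj_t mulr0.
rewrite (mulrA U) Us digit_projSt digit_proj_t mulr0.
rewrite (mulrA (star U)) odometer_starS -mulrA [t ^+ l.+2]exprS (mulrA (star U) t).
rewrite odometer_starT digit_projSt digit_projSs digit_proj_t !mulr0.
by rewrite (hom0 (phi_hom n)) !mulr0 !addr0 mul0r.
Qed.

(** On words of ones from the [n]-th digit on, only adding 1 turns the last digit
into 0. *)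
Lemma laurent_extract l : (0 < l)%N ->
  digit_proj (n + l) * b * iter n phi (t ^+ l.+1) =
  iter n phi (s ^+ l.+1) * (c1 * iter n phi U).
Proof.
case: l => // l _.
rewrite digit_projD compressed_laurent digit_proj_t odometer_tX.
rewrite (mulrA (digit_proj _)) digit_proj_s (homM (phi_hom n)) (mulrA c1) h1.
rewrite [t ^+ l.+2]exprS (mulrA (star U)) odometer_starT digit_projSs digit_proj_t.
by rewrite mulr0 (hom0 (phi_hom n)) !mulr0 add0r addr0 mulrA.
Qed.

End Laurent.

Hypothesis w_laurent : forall e : R, 0 < e -> exists n c0 c1 c2,
  [/\ forall z, c0 * iter n phi z = iter n phi z * c0,
      forall z, c1 * iter n phi z = iter n phi z * c1,
      forall z, c2 * iter n phi z = iter n phi z * c2 &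
      nrm (w - (c0 + c1 * iter n phi U + c2 * iter n phi (star U))) < e].

Let st_isometry k l : nrm (s ^+ k * t ^+ l) <= 1.
Proof.
have [ss tt _] := hst.
by rewrite nrm_isometryM ?nrm_isometry//; apply: isometryX.
Qed.

Lemma compressed_close l y b : nrm y <= 1 ->
  nrm (digit_proj l * w * y) <= nrm (digit_proj l * b * y) + nrm (w - b).
Proof.
move=> y1; have -> : digit_proj l * w * y = digit_proj l * b * y + digit_proj l * (w - b) * y.
  by rewrite -mulrDl -mulrDr addrC subrK.
apply: le_trans (nrmD _ _) _; rewrite lerD2l.
by rewrite (le_trans (nrmM_le1r _ y1))// nrmM_le1l// digit_proj_le1.
Qed.

Lemma commuted_close l n y : nrm y <= 1 ->
  `|nrm (digit_proj l * x n * y) - nrm (digit_proj l * y)| <=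
    nrm (digit_proj l * x n - x n * digit_proj l).
Proof.
move=> y1; have [x1 _] := shift_cocycle_unitary hst n w_unitary.
set d := _ - _ * _.
have e1 : digit_proj l * x n * y = x n * (digit_proj l * y) + d * y.
  by rewrite /d mulrBl mulrA addrC subrK.
have <- : nrm (x n * (digit_proj l * y)) = nrm (digit_proj l * y).
  exact: nrm_isometryM.
have dy := nrmM_le1r d y1; rewrite ler_norml; apply/andP; split.
  have := nrmD (digit_proj l * x n * y) (- (d * y)); rewrite nrmN {1}e1 addrK.
  by lra.
by have := nrmD (x n * (digit_proj l * y)) (d * y); rewrite -e1; lra.
Qed.

(** Since [w s^(n+1) = x_(n+1) s^(n+1) w] and [x_(n+1)] almost commutes with the
digit projection, [p_l w t^(l+1)] has almost the norm of
[p_(n+1+l) w s^(n+1) t^(l+1)].  Near [w] there is a Laurent element of level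
[n], for which the latter is 0. *)
Lemma off_diagonal_vanish (e : R) : 0 < e -> exists m, forall l, (m <= l)%N ->
  nrm (digit_proj l * w * t ^+ l.+1) <= e.
Proof.
move=> e0; have e2 : 0 < e / 2 by lra.
have [n [c0 [c1 [c2 [h0 h1 h2 wb]]]]] := w_laurent e2.
have [m hm] := x_central n.+1 e2.
exists m.+1 => l ml; have l0 : (0 < l)%N by lia.
have hml : (m <= n.+1 + l)%N by lia.
have h3 := compressed_close (n.+1 + l) (c0 + c1 * iter n phi U + c2 * iter n phi (star U))
  (st_isometry n.+1 l.+1).
rewrite laurent_kill// nrm0 add0r in h3.
have [u1 _] := w_unitary; have [ss tt _] := hst.
have wy : w * (s ^+ n.+1 * t ^+ l.+1) = x n.+1 * (s ^+ n.+1 * (w * t ^+ l.+1)).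
  rewrite {1}(shift_cocycleK hst n.+1 w_unitary) mulrA -(mulrA (x _)).
  by rewrite (iter_shiftMl hst) !mulrA.
rewrite -mulrA wy mulrA in h3.
have y1 : nrm (s ^+ n.+1 * (w * t ^+ l.+1)) <= 1.
  by rewrite !nrm_isometryM ?nrm_isometry//; apply: isometryX.
have := commuted_close (n.+1 + l) n.+1 y1; rewrite ler_norml => /andP[+ _].
have -> : digit_proj (n.+1 + l) * (s ^+ n.+1 * (w * t ^+ l.+1)) =
    s ^+ n.+1 * (digit_proj l * w * t ^+ l.+1).
  by rewrite digit_projD mulrA (iter_shiftMl hst) !mulrA.
rewrite [nrm (s ^+ _ * _)]nrm_isometryM; last exact: isometryX.
by have := hm _ hml; lra.
Qed.

Lemma off_diagonal_vanish_level n (e : R) : 0 < e -> exists m, forall l, (m <= l)%N ->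
  nrm (digit_proj (n + l) * w * iter n phi (t ^+ l.+1)) <= e.
Proof.
move=> e0; have e2 : 0 < e / 2 by lra.
have [m hm] := x_central n e2; have [k hk] := off_diagonal_vanish e2.
exists (maxn m k) => l ml.
have hml : (m <= n + l)%N by lia.
have hkl : (k <= l)%N by lia.
have [u1 _] := w_unitary; have [ss tt _] := hst.
have wy : w * iter n phi (t ^+ l.+1) = x n * iter n phi (w * t ^+ l.+1).
  by rewrite {1}(shift_cocycleK hst n w_unitary) -mulrA -(homM (phi_hom n)).
rewrite -mulrA wy mulrA.
have y1 : nrm (iter n phi (w * t ^+ l.+1)) <= 1.
  apply: le_trans (unital_star_hom_contractive _ (phi_hom n)) _.
  by rewrite nrm_isometryM ?nrm_isometry//; apply: isometryX.
have := commuted_close (n + l) n y1; rewrite ler_norml => /andP[_ +].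
rewrite digit_projD -(homM (phi_hom n)) mulrA.
have := unital_star_hom_contractive (digit_proj l * w * t ^+ l.+1) (phi_hom n).
have := hm _ hml; have := hk _ hkl; rewrite digit_projD.
by lra.
Qed.

(** Compressing by a digit projection on the left and a word of ones on the right
keeps the [U]-term of the Laurent element and sends [w] to almost 0. *)
Lemma laurent_coefficient_le n (c0 c1 c2 : A) :
  (forall z, c0 * iter n phi z = iter n phi z * c0) ->
  (forall z, c1 * iter n phi z = iter n phi z * c1) ->
  (forall z, c2 * iter n phi z = iter n phi z * c2) ->
  nrm (c1 * iter n phi U) <=
    nrm (w - (c0 + c1 * iter n phi U + c2 * iter n phi (star U))).
Proof.
move=> h0 h1 h2; apply/ler_addgt0Pr => e e0.
have [m hm] := off_diagonal_vanish_level n e0.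
have [ss tt _] := hst.
have ti : nrm (iter n phi (t ^+ m.+2)) <= 1.
  apply: le_trans (unital_star_hom_contractive _ (phi_hom n)) _.
  by rewrite nrm_isometry//; apply: isometryX.
have si : isometry_element (iter n phi (s ^+ m.+2)).
  by apply: (hom_isometry (phi_hom n)); apply: isometryX.
rewrite -(nrm_isometryM _ si) -(laurent_extract h0 h1 h2)//.
set b := c0 + _ + _.
have -> : digit_proj (n + m.+1) * b * iter n phi (t ^+ m.+2) =
    digit_proj (n + m.+1) * w * iter n phi (t ^+ m.+2) +
    digit_proj (n + m.+1) * (b - w) * iter n phi (t ^+ m.+2).
  by rewrite -mulrDl -mulrDr addrC subrK.
apply: le_trans (nrmD _ _) _; rewrite addrC lerD// ?hm//.
rewrite (le_trans (nrmM_le1r _ ti))// (le_trans (nrmM_le1l _ _)) ?digit_proj_le1//.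
by rewrite nrmB.
Qed.

End OffDiagonal.

Theorem theorem6p4 (R : realType) (Q2 : cstarAlgType R) (U S2 : Q2)
    (hQ2 : is_Q2 U S2)
    (alpha : R -> {lrmorphism Q2 -> Q2})
    (halpha : gauge_automorphisms U S2 alpha)
    (w : Q2) (w_unitary : unitary_element w) (w_fixed : fixed_points alpha w)
    (w_incl : [set w * x * star w | x in O2 U S2] `<=` O2 U S2) :
  F2 U S2 alpha w /\ [set w * x * star w | x in O2 U S2] = O2 U S2.
Proof.
have [hrel gen _] := hQ2.
have hU := Q2_odometer hrel; set t := U * S2 in hU.
have [hst _ _ _] := hU.
have alphaS theta : star_preserving (alpha theta) by case: (halpha theta) => [[]].
have alpha_s theta : alpha theta S2 = expi theta *: S2 by case: (halpha theta).
have alpha_U theta : alpha theta U = U by case: (halpha theta).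
pose O := O2 U S2; pose phi := cuntz_shift S2 t.
have Osub : cstar_subalgebra O by exact: generated_cstar_subalgebra.
have [Oclosed _ OM OS] := Osub.
have Os : O S2 by apply: sub_gen_smallest; right.
have Ot : O t by apply: sub_gen_smallest; left.
have Ogen : O = cstar_generated [set t; S2] by [].
clearbody t.
have [u1 u2] := w_unitary.
have hw z : O z -> O (w * z * star w) by move=> Oz; apply: w_incl; exists z.
have x_central q n (e : R) : nrm q <= 1 -> 0 < e -> exists m, forall l, (m <= l)%N ->
    nrm (iter l phi q * shift_cocycle S2 t w n -
         shift_cocycle S2 t w n * iter l phi q) <= e.
  have [Ox fx] := shift_cocycle_core hU alphaS alpha_s alpha_U Osub Os Ot n
    w_unitary w_fixed hw.
  rewrite {1}Ogen in Ox => q1 e0.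
  exact: (core_asymptotically_central hU alphaS alpha_s alpha_U Osub Os Ot).
have [ss tt _] := hst.
have w_laurent (e : R) : 0 < e -> exists n c0 c1 c2,
    [/\ core_level S2 t alpha O n c0, core_level S2 t alpha O n c1,
        core_level S2 t alpha O n c2 &
        nrm (w - (c0 + c1 * iter n phi U + c2 * iter n phi (star U))) < e].
  have : closure (laurent_union U S2 t alpha O) w.
    by apply: laurent_approx => //; rewrite gen.
  move=> /closure_nrmP h /h [y [n [c0 [c1 [c2 [h0 h1 h2 ->]]]]] we].
  by exists n, c0, c1, c2.
have Ow : O w.
  (* [c0] is within [3 * (e / 3)] of [w]: the error of the approximation, and one
     such error for each of the two other coefficients. *)
  have -> : O = closure O by apply/closure_id.
  apply/closure_nrmP => e e0; have e3 : 0 < e / 3 by rewrite divr_gt0.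
  have [n [c0 [c1 [c2 [[F0 h0] [_ h1] [_ h2] we]]]]] := w_laurent _ e3.
  exists c0; first by case: F0.
  have b1 : nrm (c1 * iter n phi U) <=
      nrm (w - (c0 + c1 * iter n phi U + c2 * iter n phi (star U))).
    apply: (laurent_coefficient_le hU w_unitary) => //.
    - by move=> k d d0; apply: x_central => //; apply: nrm_range_proj_le1.
    - move=> d /w_laurent [k [a0 [a1 [a2 [[_ k0] [_ k1] [_ k2] ab]]]]].
      by exists k, a0, a1, a2.
  have b2 : nrm (c2 * iter n phi (star U)) <=
      nrm (w - (c0 + c1 * iter n phi U + c2 * iter n phi (star U))).
    have := @laurent_coefficient_le _ _ _ _ _ (odometer_flip hU) w w_unitary.
    rewrite /digit_proj /shift_cocycle -(cuntz_shiftC S2) starK -/phi addrAC; apply => //.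
    - by move=> k d d0; apply: x_central => //; apply: nrm_range_proj_le1.
    - move=> d /w_laurent [k [a0 [a1 [a2 [[_ k0] [_ k1] [_ k2] ab]]]]].
      by exists k, a0, a2, a1; split => //; rewrite addrAC.
  have := nrm_triangle w (c0 + c1 * iter n phi U + c2 * iter n phi (star U)) c0.
  have cK (p q : Q2) : c0 + p + q - c0 = p + q by rewrite addrAC [c0 + p]addrC addrK.
  rewrite cK.
  by have := nrmD (c1 * iter n phi U) (c2 * iter n phi (star U)); lra.
split; first by split.
apply/seteqP; split => // y Oy; exists (star w * y * w).
  exact: (OM _ _ (OM _ _ (OS _ Ow) Oy) Ow).
by rewrite !mulrA u2 mul1r -mulrA u2 mulr1.
Qed.
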